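(* Assume each $f_j:\mathbb R^n\to\mathbb R$ ($1\le j\le m$) is continuously differentiable with $L_j$-Lipschitz gradient and $\mu_j$-strongly convex ($0\le\mu_j\le L_j<\infty$), and let $\mu=\min_j\mu_j$. Let $\gamma_0>0$, $x_0,x_1\in\mathbb R^n$, and $\gamma(t)=\mu+(\gamma_0-\mu)e^{-t}$. Let $X,Z:[0,\infty)\to\mathbb R^n$ be locally absolutely continuous with $X(0)=x_0$, $Z(0)=x_0+x_1$, satisfying for almost every $t>0$ $$X'(t)=Z(t)-X(t),\qquad \gamma(t)Z'(t)\in\mu\big(X(t)-Z(t)\big)-\operatorname*{argmin}_{v\in C(X(t))}\langle X(t)-Z(t),v\rangle.$$ For $z\in\mathbb R^n$ define $\mathcal E(t;z):=f(X(t);z)+\frac{\gamma(t)}{2}\|Z(t)-z\|^2$. Then for every $z\in\mathbb R^n$ and almost every $t>0$, $$\frac{d}{dt}\mathcal E(t;z)\le-\mathcal E(t;z)-\frac{\mu}{2}\|Z(t)-X(t)\|^2,$$ and consequently for all $t>0$, $$f(X(t);z)+\frac{\gamma(t)}{2}\|Z(t)-z\|^2\le e^{-t}\Big(f(x_0;z)+\frac{\gamma_0}{2}\|x_0+x_1-z\|^2\Big).$$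
   Context: A function $g$ is $\mu_j$-strongly convex if $g(z)\ge g(y)+\langle\nabla g(y),z-y\rangle+\frac{\mu_j}{2}\|z-y\|^2$ for all $y,z$ ($\mu_j=0$: convex). $C(x)=\mathrm{conv}\{\nabla f_1(x),\dots,\nabla f_m(x)\}$. $f(x;z):=\min_{1\le j\le m}[f_j(x)-f_j(z)]$. The parameter $\gamma$ solves $\gamma'=\mu-\gamma$, $\gamma(0)=\gamma_0$. *)

(* Defs.v *)
(* R^n is rendered as 'rV[R]_n with the Euclidean
   inner product/norm defined below (MathComp's built-in norm on 'rV is the
   sup norm, so we do NOT use it). *)
From HB Require Import structures.
From mathcomp Require Import all_boot all_order all_algebra.
From mathcomp Require Import all_classical all_reals all_analysis.
Import Order.TTheory GRing.Theory Num.Theory.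
Import numFieldNormedType.Exports.
Local Open Scope ring_scope.
Local Open Scope classical_set_scope.

Section Defs.
Context {R : realType} {n : nat}.

Definition dotv (u v : 'rV[R]_n) : R := \sum_(i < n) u 0 i * v 0 i.
Definition enorm (u : 'rV[R]_n) : R := Num.sqrt (dotv u u).

Definition is_gradient (f : 'rV[R]_n -> R) (g : 'rV[R]_n -> 'rV[R]_n) : Prop :=
  forall x, differentiable f x /\ forall h, 'd f x h = dotv (g x) h.

Definition lipschitz_grad (g : 'rV[R]_n -> 'rV[R]_n) (L : R) : Prop :=
  forall x y, enorm (g x - g y) <= L * enorm (x - y).

Definition strongly_convex (f : 'rV[R]_n -> R) (g : 'rV[R]_n -> 'rV[R]_n)
  (mu : R) : Prop :=
  forall y z, f y + dotv (g y) (z - y) + mu / 2 * enorm (z - y) ^+ 2 <= f z.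

Definition convC {m : nat} (g : 'I_m -> 'rV[R]_n -> 'rV[R]_n) (x : 'rV[R]_n)
  (v : 'rV[R]_n) : Prop :=
  exists lam : 'I_m -> R, (forall j, 0 <= lam j) /\ \sum_(j < m) lam j = 1 /\
    v = \sum_(j < m) lam j *: g j x.

Definition argminC {m : nat} (g : 'I_m -> 'rV[R]_n -> 'rV[R]_n) (x d : 'rV[R]_n)
  (v : 'rV[R]_n) : Prop :=
  convC g x v /\ forall w, convC g x w -> dotv d v <= dotv d w.

(* f(x; z) = min_j [f_j(x) - f_j(z)]  (indices j : 'I_m.+1, i.e. m+1 >= 1 objectives) *)
Definition fgap {m : nat} (f : 'I_m.+1 -> 'rV[R]_n -> R) (x z : 'rV[R]_n) : R :=
  \big[Num.min/(f ord0 x - f ord0 z)]_(j < m.+1) (f j x - f j z).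

Definition minmu {m : nat} (mu : 'I_m.+1 -> R) : R :=
  \big[Num.min/(mu ord0)]_(j < m.+1) mu j.

Definition gammaf (mu gamma0 t : R) : R := mu + (gamma0 - mu) * expR (- t).

Definition abs_cont_on (a b : R) (F : R -> 'rV[R]_n) : Prop :=
  forall e : R, 0 < e -> exists2 d : R, 0 < d &
    forall (k : nat) (s t : 'I_k -> R),
      (forall i, [&& a <= s i, s i <= t i & t i <= b]) ->
      (forall i j, i != j -> t i <= s j \/ t j <= s i) ->
      \sum_(i < k) (t i - s i) < d ->
      \sum_(i < k) enorm (F (t i) - F (s i)) < e.

Definition loc_abs_cont (F : R -> 'rV[R]_n) : Prop :=
  forall T : R, 0 < T -> abs_cont_on 0 T F.

Definition energy {m : nat} (f : 'I_m.+1 -> 'rV[R]_n -> R) (gam : R -> R)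
  (X Z : R -> 'rV[R]_n) (z : 'rV[R]_n) (t : R) : R :=
  fgap f (X t) z + gam t / 2 * enorm (Z t - z) ^+ 2.

End Defs.

(* Main.v *)
(* The selection [v] maximizes [<., X'>] over [C(X)], so the derivative of the
   gap, which is [<grad f_j(X), X'>] for any active [j], is at most [<v, X'>];
   strong convexity bounds [<v, z - X>], and the rest of the estimate is a
   polarization identity.  A minimum of functions that are differentiable almost
   everywhere is again so: two of them can cross with different slopes only at
   isolated points, hence on a countable set.  For the integrated estimate,
   [expR t * E t] is absolutely continuous with nonpositive derivative almost
   everywhere, hence nonincreasing; this last fact is proved by a covering
   argument that puts the exceptional null set in an open set of small measure
   and moves right from 0 by a supremum argument. *)
Require Import Defs.
From HB Require Import structures.
From mathcomp Require Import all_boot all_order all_algebra.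
From mathcomp Require Import all_classical all_reals all_analysis.
From mathcomp Require Import ring lra.
Import Order.TTheory GRing.Theory Num.Theory.
Import numFieldNormedType.Exports.
Local Open Scope ring_scope.
Local Open Scope classical_set_scope.

(** * Minima of almost everywhere differentiable functions *)

Section minimum_of_derivable_functions.
Context {R : realType}.
Implicit Types h f g : R -> R.

(** A derivative of nonzero sign fixes the sign of the difference quotient near 0, and a step of the
    right sign then goes below the minimum. *)
Lemma derive_at_global_min h (c : R) :
  derivable h c 1 -> (forall s, h c <= h s) -> 'D_1 h c = 0.
Proof.
move=> dh hmin.
(* [sg] selects the sign to refute: a positive derivative is tested with the step [- (e / 2)], a
   negative one with [e / 2]. *)
have key (sg : bool) : (if sg then 'D_1 h c > 0 else 'D_1 h c < 0) -> False.
  move=> hl.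
  have [e /= e0 He] : \forall x \near 0^', 
      if sg then 0 < x^-1 *: (h (x *: 1 + c) - h c) 
      else x^-1 *: (h (x *: 1 + c) - h c) < 0.
    by case: sg hl => hl; [apply: (cvgr_gt ('D_1 h c)) | apply: (cvgr_lt ('D_1 h c))].
  have /= := He (if sg then - (e / 2) else e / 2).
  have e2 : 0 < e / 2 by rewrite divr_gt0.
  have -> : `|0 - (if sg then - (e / 2) else e / 2)| < e.
    rewrite sub0r; case: (sg); rewrite ?opprK ?normrN gtr0_norm//; lra.
  have -> : (if sg then - (e / 2) else e / 2) != 0.
    by case: (sg); rewrite ?oppr_eq0 gt_eqF.
  move=> /(_ isT isT); case: (sg); apply/negP; rewrite -leNgt.
    by rewrite mulr_le0_ge0 ?subr_ge0// invr_le0 oppr_le0 ltW.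
  by rewrite mulr_ge0 ?subr_ge0// invr_ge0 ltW.
apply/eqP; rewrite eq_le; apply/andP; split; rewrite leNgt; apply/negP.
  exact: (key true).
exact: (key false).
Qed.

(** The difference quotient at [t] tends to a nonzero limit, so it has no zero at small nonzero
    steps; as [h t = 0], neither has [h]. *)
Lemma isolated_simple_zero h (t : R) :
  h t = 0 -> derivable h t 1 -> 'D_1 h t != 0 -> isolated [set s | h s = 0] t.
Proof.
move=> ht dh dn0; split; first by rewrite inE.
have [e /= e0 He] : \forall x \near 0^', x^-1 *: (h (x *: 1 + t) - h t) != 0.
  exact: (cvgr_neq0 ('D_1 h t)).
exists (ball t e); first exact: nbhsx_ballx.
apply/seteqP; split=> [s [/= ts hs]|s ->]; last by split => //; exact: ballxx.
apply/eqP; apply: contrapT => /negP st.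
have := He (s - t); rewrite /ball_/= sub0r opprB subr_eq0 st => /(_ ts isT).
by rewrite scaler1 subrK hs ht subrr scaler0 eqxx.
Qed.

(** The difference quotients of [h] and of its absolute value have the same modulus at [t], so both
    tend to 0. *)
Lemma derivable_norm_double_zero h (t : R) :
  h t = 0 -> derivable h t 1 -> 'D_1 h t = 0 -> derivable (fun s => `|h s|) t 1.
Proof.
move=> ht dh dh0; apply/cvg_ex; exists 0; apply/norm_cvg0P.
have : (fun x => x^-1 *: (h (x *: 1 + t) - h t)) @ 0^' --> 'D_1 h t by [].
rewrite dh0 => /cvg_norm; rewrite normr0; apply: cvg_trans; apply: near_eq_cvg; near=> x.
by rewrite /= ht normr0 !subr0 !normrZ normr_id.
Unshelve. all: by end_near. Qed.

Lemma derivable_min_tangent f g (t : R) : f t = g t ->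
  derivable f t 1 -> derivable g t 1 -> 'D_1 f t = 'D_1 g t ->
  derivable (f \min g) t 1.
Proof.
move=> fgt df dg dfg.
have -> : f \min g = (2^-1 : R) \*: (f + g - (fun s => `|f s - g s|)).
  apply/funext => s /=; rewrite minr_absE mulrC.
  by rewrite -[RHS]/(2^-1 * (f s + g s - `|f s - g s|)).
apply: derivableZ; apply: derivableB; first exact: derivableD.
apply: (@derivable_norm_double_zero (f - g)); last by rewrite deriveB// dfg subrr.
  by rewrite /= -[LHS]/(f t - g t) fgt subrr.
exact: derivableB.
Qed.

Lemma ae_lebesgue_filter :
  Filter (nbhs (almost_everywhere (@lebesgue_measure R))).
Proof. exact: ae_filter_ringOfSetsType. Qed.

Lemma ae_derivable_min f g (D : set R) :
  {ae (@lebesgue_measure R), forall t, D t -> derivable f t 1} ->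
  {ae (@lebesgue_measure R), forall t, D t -> derivable g t 1} ->
  {ae (@lebesgue_measure R), forall t, D t -> derivable (f \min g) t 1}.
Proof.
move=> df dg.
(* Transversal crossings of [f] and [g] are isolated zeros of [f - g]; the isolated points of a set
   of reals are countable, hence negligible. *)
have iso0 : {ae (@lebesgue_measure R),
    forall t, ~ isolated [set s | (f - g) s = 0] t}.
  have ci := countable_isolated [set s | (f - g) s = 0].
  exists (isolated [set s | (f - g) s = 0]); split.
  - by apply: countable_measurable.
  - exact: countable_lebesgue_measure0.
  - by move=> t /= /contrapT.
move: df dg iso0; apply: (@filterS3 _ _ ae_lebesgue_filter) => t df dg iso Dt.
have {}df := df Dt; have {}dg := dg Dt.
have cf h : derivable h t 1 -> {for t, continuous h}.
  by move/derivable1_diffP/differentiable_continuous.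
(* Where the values differ, continuity makes the minimum coincide with one of the functions near
   [t]. Where they agree, the slopes must agree too. *)
have [fgt|fgt] := eqVneq (f t) (g t); last first.
  by apply: derivable_min => //; exact: cf.
apply: derivable_min_tangent => //; apply/eqP/negPn/negP => ne; apply: iso.
apply: isolated_simple_zero; first by rewrite -[LHS]/(f t - g t) fgt subrr.
  exact: derivableB.
by rewrite deriveB// subr_eq0.
Qed.

Lemma ae_derivable_bigmin (I : Type) (r : seq I) (a0 : R -> R) (a : I -> R -> R)
    (D : set R) :
  {ae (@lebesgue_measure R), forall t, D t -> derivable a0 t 1} ->
  (forall i, {ae (@lebesgue_measure R), forall t, D t -> derivable (a i) t 1}) ->
  {ae (@lebesgue_measure R), forall t, D t ->
     derivable (fun s => \big[Num.min/a0 s]_(i <- r) a i s) t 1}.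
Proof.
move=> h0 ha; elim: r => [|i r IH].
  by have -> : (fun s => \big[Num.min/a0 s]_(i <- [::]) a i s) = a0
    by apply/funext => s; rewrite big_nil.
have -> : (fun s => \big[Num.min/a0 s]_(j <- i :: r) a j s) =
    a i \min (fun s => \big[Num.min/a0 s]_(j <- r) a j s).
  by apply/funext => s; rewrite big_cons.
exact: ae_derivable_min.
Qed.

End minimum_of_derivable_functions.

(** * Absolute continuity and monotonicity *)

Section absolutely_continuous_monotone.
Context {R : realType}.
Implicit Types F : R -> R.

(** Intervals are listed from left to right and indexed by [nat], so that a new rightmost interval
    can be appended at index [k] without reindexing. *)
Definition real_abs_cont_on (T : R) F : Prop :=
  forall e : R, 0 < e -> exists2 d : R, 0 < d &
    forall (k : nat) (a b : nat -> R),
      (forall i, (i < k)%N -> [&& 0 <= a i, a i <= b i & b i <= T]) ->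
      (forall i j, (i < j < k)%N -> b i <= a j) ->
      \sum_(i < k) (b i - a i) < d ->
      \sum_(i < k) `|F (b i) - F (a i)| < e.

(** The increment is split at [p]; on each side the difference quotient at [p] is below [e]. *)
Lemma straddle F (p e : R) : 0 < e -> derivable F p 1 -> 'D_1 F p <= 0 ->
  exists2 r, 0 < r & forall y v, p - r < y <= p -> p <= v < p + r ->
    F v - F y <= e * (v - y).
Proof.
move=> e0 dF dF0.
have [r /= r0 Hr] : \forall x \near 0^', x^-1 *: (F (x *: 1 + p) - F p) < e.
  by apply: (cvgr_lt ('D_1 F p)) => //; exact: le_lt_trans dF0 e0.
have step x : `|x| < r -> x != 0 -> x^-1 * (F (x + p) - F p) < e.
  move=> xr x0; have := Hr x; rewrite /= sub0r normrN => /(_ xr x0).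
  by rewrite scaler1.
exists r => // y v /andP[yr yp] /andP[pv vr].
have Hv : F v - F p <= e * (v - p).
  have [->|vp] := eqVneq v p; first by rewrite !subrr mulr0.
  have vp0 : 0 < v - p by rewrite subr_gt0 lt_neqAle eq_sym vp.
  have := step (v - p); rewrite subrK gtr0_norm// gt_eqF// => /(_ _ isT) H.
  by rewrite mulrC -ler_pdivrMl// ltW// H// ltrBlDl.
have Hy : F p - F y <= e * (p - y).
  have [->|yp'] := eqVneq y p; first by rewrite !subrr mulr0.
  have vp0 : y - p < 0 by rewrite subr_lt0 lt_neqAle yp'.
  have := step (y - p); rewrite subrK ltr0_norm// lt_eqF// => /(_ _ isT) H.
  have {H} : (y - p)^-1 * (F y - F p) < e by apply: H; lra.
  by rewrite ltr_ndivrMl// => H; lra.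
lra.
Qed.

(** Off the exceptional set, [F] climbs with slope at most [e]; the remaining steps have total
    length below [d], so absolute continuity bounds their contribution by [e]. *)
Lemma abs_cont_nonincreasing F (T : R) : 0 < T -> real_abs_cont_on T F ->
  {ae (@lebesgue_measure R), forall t, 0 < t -> derivable F t 1 /\ 'D_1 F t <= 0} ->
  F T <= F 0.
Proof.
move=> T0 acF [A [mA A0 NA]].
suff main e : 0 < e -> F T - F 0 <= e * T + e.
  rewrite -subr_le0; apply/ler_addgt0Pr => e e0; rewrite add0r.
  have T1 : 0 < T + 1 by rewrite addr_gt0.
  have := main (e / (T + 1)) (divr_gt0 e0 T1).
  suff -> : e / (T + 1) * T + e / (T + 1) = e by [].
  by field; rewrite gt_eqF.
move=> e0; have [d d0 Hd] := acF _ e0.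
pose mu := @lebesgue_measure R.
have mono (B C : set R) : measurable B -> measurable C -> B `<=` C ->
    (mu B <= mu C)%E.
  by move=> mB mC BC; apply: le_measure; rewrite ?inE.
(* The derivative hypothesis says nothing at 0, so 0 joins the exceptional set. *)
pose D : set R := A `|` [set 0].
have mD : measurable D by apply: measurableU => //; exact: measurable_set1.
have D0 : mu D = 0%E.
  apply/eqP; rewrite -measure_le0 (le_trans (measureU2 _ _ _))//=.
  by rewrite [X in (X + _)%E]A0 [X in (_ + X)%E]lebesgue_measure_set1 adde0.
have [U [oU DU UD]] : exists U : set R, [/\ open U , D `<=` U & (mu (U `\` D) < d%:E)%E].
  by apply: lebesgue_regularity_outer => //; rewrite [X in (X < _)%E]D0 ltry.
have mU : measurable U by exact: measurable_realfun.open_measurable.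
have Ud : (mu U < d%:E)%E.
  have mUD : measurable (U `\` D) by exact: measurableD.
  rewrite -(setDUK DU); apply: (le_lt_trans (measureU2 _ _ _)) => //.
  by rewrite [X in (X + _)%E]D0 add0e.
pose V (x : R) : set R := U `&` `]0, x].
(* [a i, b i] are the steps taken so far at exceptional points; their total
   length is controlled by the measure of [U]. *)
pose Inv x := exists (k : nat) (a b : nat -> R),
  [/\ forall i, (i < k)%N -> [&& 0 <= a i, a i <= b i & b i <= x],
      forall i j, (i < j < k)%N -> b i <= a j,
      ((\sum_(i < k) (b i - a i))%:E <= mu (V x))%E &
      F x - F 0 <= e * x + \sum_(i < k) `|F (b i) - F (a i)|].
have mV x : measurable (V x) by apply: measurableI.
(* The invariant passes from any [y] just left of [p] to any [v] just right of it. If [p] is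
   exceptional, [[y, v]] is recorded as a new step inside [U]; otherwise [straddle] pays for the
   increment by the slope term. *)
have step p : 0 <= p -> exists2 r, 0 < r & forall y v, 0 <= y ->
    p - r < y <= p -> p <= v < p + r -> Inv y -> Inv v.
  move=> p0; have [pD|pD] := pselect (D p).
    have [r /= r0 Hr] : nbhs p U by apply: open_nbhs_nbhs; split => //; exact: DU.
    exists r => // y v y0 /andP[yr yp] /andP[pv vr] [k [a [b [Hab Hd' Hm HF]]]].
    exists k.+1, (fun i => if i == k then y else a i),
      (fun i => if i == k then v else b i).
    have yv := le_trans yp pv.
    have neqk (i : 'I_k) : (i == k :> nat) = false by rewrite ltn_eqF.
    split.
    - move=> i; rewrite ltnS leq_eqVlt; case: eqVneq => [_ _|_ /= ik].
        by rewrite y0 yv lexx.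
      by have /and3P[-> -> /le_trans->] := Hab i ik.
    - move=> i j; rewrite ltnS => /andP[ij jk].
      rewrite (ltn_eqF (leq_trans ij jk)); case: eqVneq => [jk'|jk'].
        by have /and3P[] := Hab i (leq_trans ij jk).
      by apply: Hd'; rewrite ij ltn_neqAle jk'.
    - rewrite big_ord_recr /= eqxx EFinD.
      under eq_bigr do rewrite neqk.
      (* The half-open interval is disjoint from [V y], so its length adds to the measure, and the
         union lies in [V v]. *)
      apply: (@le_trans _ _ (mu (V y `|` `]y, v]))).
        have dis : V y `&` `]y, v] = set0.
          rewrite -subset0 => x [/= [_]]; rewrite /= !in_itv/= => /andP[_ xy].
          by rewrite ltNge xy.
        have -> : mu (V y `|` `]y, v]) =
            adde (mu (V y)) (mu `]y, v]).
          have mI : measurable (`]y, v]%classic : set R) by exact: measurable_itv.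
          exact (@measureU _ _ _ (@lebesgue_measure R) _ _ (mV y) mI dis).
        apply: leeD => //; rewrite /mu lebesgue_measure_itv/= lte_fin.
        case: ltP => [_|vy]; first by rewrite EFinB.
        by rewrite lee_fin subr_le0.
      apply: mono => //; first by apply: measurableU => //; exact: measurable_itv.
      move=> x [[Ux]|]; rewrite /= !in_itv/= => /andP[x1 x2]; split => //=.
      - by rewrite in_itv/= x1 (le_trans x2).
      - by apply: Hr; rewrite /ball_/= ltr_distl; apply/andP; split; lra.
      - by rewrite in_itv/= x2 (le_lt_trans y0).
    - rewrite big_ord_recr /= eqxx.
      under eq_bigr do rewrite neqk.
      have := ler_norm (F v - F y).
      have : e * y <= e * v by rewrite ler_pM2l.
      lra.
  have pgt0 : 0 < p.
    by rewrite lt_neqAle p0 andbT; apply/eqP => p0'; apply: pD; right.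
  have [dF dF0] : derivable F p 1 /\ 'D_1 F p <= 0.
    apply: contrapT => H; apply: pD; left; apply: NA => /= H'.
    exact/H/H'.
  have [r r0 Hr] := straddle _ _ _ e0 dF dF0.
  exists r => // y v y0 Hy Hv [k [a [b [Hab Hd' Hm HF]]]].
  have := Hr y v Hy Hv; move: Hy Hv => /andP[yr yp] /andP[pv vr] HF'.
  have yv := le_trans yp pv.
  exists k, a, b; split => //.
  - by move=> i /Hab /and3P[-> -> /le_trans->].
  - apply: (le_trans Hm); apply: mono => //.
    move=> x [Ux] /=; rewrite in_itv/= => /andP[x0 xy]; split => //=.
    by rewrite in_itv/= x0 (le_trans xy).
  - lra.
pose S := [set x | 0 <= x <= T /\ Inv x].
have S0 : S 0.
  split; first by rewrite lexx ltW.
  exists 0%N, (fun=> 0), (fun=> 0); split => //.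
    by rewrite big_ord0 measure_ge0.
  by rewrite big_ord0 mulr0 subrr addr0.
have supS : has_sup S.
  by split; [exists 0 | exists T => x [/andP[]]].
pose p := sup S.
have p0 : 0 <= p by apply: ub_le_sup => //; case: supS.
have [r r0 Hr] := step _ p0.
have [y [/andP[y0 yT] Iy] yr] := sup_adherent r0 supS.
have yp : y <= p by apply: ub_le_sup; [case: supS | split => //; rewrite y0].
have pT : p <= T by apply: ge_sup; [exists 0 | move=> x [/andP[]]].
(* Either one step from [y] reaches [T], or it reaches [p + r / 2], beyond the supremum. *)
have IT : Inv T.
  have [Tr|Tr] := ltP T (p + r).
    by apply: (Hr y) => //; [rewrite yr | rewrite pT].
  have Iv : Inv (p + r / 2).
    by apply: (Hr y) => //; [rewrite yr | apply/andP; split; lra].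
  have : p + r / 2 <= p.
    apply: ub_le_sup; first by case: supS.
    by split => //; apply/andP; split; lra.
  lra.
have [k [a [b [Hab Hd' Hm HF]]]] := IT.
apply: (le_trans HF); rewrite lerD2l ltW//; apply: (Hd) => //.
rewrite -lte_fin (le_lt_trans Hm)// (le_lt_trans _ Ud)//.
by apply: mono => // x [].
Qed.

End absolutely_continuous_monotone.

(** * Euclidean norm *)

Section euclidean_norm.
Context {R : realType} {n : nat}.
Implicit Types u v x : 'rV[R]_n.

Lemma dotvC u v : dotv u v = dotv v u.
Proof. by apply: eq_bigr => i _; rewrite mulrC. Qed.

Lemma dotvDl u v x : dotv (u + v) x = dotv u x + dotv v x.
Proof. by rewrite /dotv -big_split; apply: eq_bigr => i _; rewrite mxE mulrDl. Qed.

Lemma dotvZl (c : R) u x : dotv (c *: u) x = c * dotv u x.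
Proof. by rewrite /dotv mulr_sumr; apply: eq_bigr => i _; rewrite mxE mulrA. Qed.

Lemma dotvNl u x : dotv (- u) x = - dotv u x.
Proof. by rewrite -scaleN1r dotvZl mulN1r. Qed.

Lemma dotvDr u v x : dotv x (u + v) = dotv x u + dotv x v.
Proof. by rewrite ![dotv x _]dotvC dotvDl. Qed.

Lemma dotvZr (c : R) u x : dotv x (c *: u) = c * dotv x u.
Proof. by rewrite ![dotv x _]dotvC dotvZl. Qed.

Lemma dotvNr u x : dotv x (- u) = - dotv x u.
Proof. by rewrite ![dotv x _]dotvC dotvNl. Qed.

Lemma dotv_suml (k : nat) (c : 'I_k -> R) (w : 'I_k -> 'rV[R]_n) x :
  dotv (\sum_j c j *: w j) x = \sum_j c j * dotv (w j) x.
Proof.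
elim/big_rec2 : _ => [|j a b _ IH].
  by rewrite /dotv big1// => i _; rewrite mxE mul0r.
by rewrite dotvDl dotvZl IH.
Qed.

Lemma dotv_ge0 u : 0 <= dotv u u.
Proof. by apply: sumr_ge0 => i _; rewrite -expr2 sqr_ge0. Qed.

Lemma enorm_ge0 u : 0 <= enorm u.
Proof. exact: sqrtr_ge0. Qed.

Lemma enorm_sqr u : enorm u ^+ 2 = dotv u u.
Proof. by rewrite sqr_sqrtr// dotv_ge0. Qed.

Lemma enormN u : enorm (- u) = enorm u.
Proof. by rewrite /enorm dotvNl dotvNr opprK. Qed.

Lemma enormB u v : enorm (u - v) = enorm (v - u).
Proof. by rewrite -enormN opprB. Qed.

Lemma coord_le_enorm u (i : 'I_n) : `|u 0 i| <= enorm u.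
Proof.
rewrite -sqrtr_sqr; apply: ler_wsqrtr.
rewrite /dotv (bigD1 i)//= expr2 lerDl.
by apply: sumr_ge0 => j _; rewrite -expr2 sqr_ge0.
Qed.

Lemma enorm0_eq0 u : enorm u = 0 -> u = 0.
Proof.
move=> u0; apply/rowP => i; rewrite mxE; apply/eqP.
by rewrite -normr_eq0 eq_le normr_ge0 andbT -u0 coord_le_enorm.
Qed.

(** Cauchy-Schwarz: expand the nonnegative square of [enorm v *: u - enorm u *: v] and cancel the
    product of the norms. *)
Lemma dotv_le_enorm u v : dotv u v <= enorm u * enorm v.
Proof.
have dot0 x : dotv 0 x = 0 by rewrite -(scale0r 0) dotvZl mul0r.
have [/enorm0_eq0 ->|u0] := eqVneq (enorm u) 0.
  by rewrite dot0 mulr_ge0// enorm_ge0.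
have [/enorm0_eq0 ->|v0] := eqVneq (enorm v) 0.
  by rewrite dotvC dot0 mulr_ge0// enorm_ge0.
have uv0 : 0 < enorm u * enorm v by rewrite mulr_gt0// lt_neqAle eq_sym ?u0 ?v0 enorm_ge0.
have := dotv_ge0 (enorm v *: u - enorm u *: v).
rewrite !(dotvDl, dotvDr, dotvNl, dotvNr, dotvZl, dotvZr) -!enorm_sqr (dotvC v u).
set a := enorm u; set b := enorm v; set c := dotv u v => H.
rewrite -(ler_pM2l uv0) -/a -/b; lra.
Qed.

Lemma ler_enormD u v : enorm (u + v) <= enorm u + enorm v.
Proof.
rewrite -(@ler_pXn2r _ 2)// ?nnegrE ?addr_ge0 ?enorm_ge0//.
rewrite enorm_sqr !(dotvDl, dotvDr) -!enorm_sqr (dotvC v u) sqrrD.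
have := dotv_le_enorm u v; lra.
Qed.

Lemma ler_enorm_distD x u v : enorm (u - v) <= enorm (u - x) + enorm (x - v).
Proof. by have := ler_enormD (u - x) (x - v); rewrite addrA subrK. Qed.

(** Cut [[0, t]] into [N] equal pieces, each shorter than the [d] that absolute continuity gives for
    increments below 1. The same [N] serves every [t] in [[0, T]]. *)
Lemma abs_cont_bounded (F : R -> 'rV[R]_n) (T : R) : 0 < T ->
  abs_cont_on 0 T F ->
  exists W, forall t, 0 <= t <= T -> enorm (F t - F 0) <= W.
Proof.
move=> T0 /(_ 1 ltr01)[d d0 Hd].
pose N := (Num.truncn (T / d)).+1.
have N0 : 0 < N%:R :> R by rewrite ltr0n.
have TN : T / N%:R < d.
  by rewrite ltr_pdivrMr// mulrC -ltr_pdivrMr// truncnS_gt.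
exists N%:R => t /andP[t0 tT].
suff H i : (i <= N)%N -> enorm (F (t / N%:R * i%:R) - F 0) <= i%:R.
  by have := H N (leqnn N); rewrite divfK// gt_eqF.
have tN0 : 0 <= t / N%:R by rewrite divr_ge0// ltW.
elim: i => [_|i IH iN].
  by rewrite mulr0 subrr /enorm -(scale0r 0) dotvZl mul0r sqrtr0.
have Hi := IH (ltnW iN).
rewrite (le_trans (ler_enorm_distD (F (t / N%:R * i%:R)) _ _))//.
rewrite -natr1 addrC lerD// ltW//.
have := Hd 1%N (fun=> t / N%:R * i%:R) (fun=> t / N%:R * (i%:R + 1)).
rewrite !big_ord1; apply.
- move=> _; apply/and3P; split.
  + by rewrite mulr_ge0.
  + by rewrite ler_wpM2l// lerDl.
  + rewrite (le_trans _ tT)// -[leRHS](divfK (lt0r_neq0 N0)) ler_wpM2l//.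
    by rewrite natr1 ler_nat.
- by move=> i0 j0; rewrite !ord1 eqxx.
- rewrite mulrDr mulr1 addrAC subrr add0r (le_lt_trans _ TN)//.
  by rewrite ler_pM2r// invr_gt0.
Qed.

End euclidean_norm.

(** * Functions Lipschitz with respect to a gauge *)

(* The increments are compared with one common gauge [w s t] so that absolute
   continuity only has to be checked for [w]. *)
Section gauge_lipschitz.
Context {R : realType}.
Variables (T : R) (w : R -> R -> R).
Hypothesis T_ge0 : 0 <= T.
Hypothesis w_ge0 : forall s t, 0 <= s -> s <= t -> t <= T -> 0 <= w s t.
Hypothesis w_bounded : exists W, forall t, 0 <= t <= T -> w 0 t <= W.
Implicit Types F G : R -> R.

Definition wlip F : Prop := exists2 K : R, 0 <= K &
  forall s t, 0 <= s -> s <= t -> t <= T -> `|F t - F s| <= K * w s t.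

Lemma wlip_bounded F : wlip F ->
  exists2 M : R, 0 <= M & forall t, 0 <= t <= T -> `|F t| <= M.
Proof.
move=> [K K0 HF]; have [W HW] := w_bounded.
have W0 : 0 <= W.
  by apply: (le_trans (w_ge0 0 0 _ _ _)) => //; apply: HW; rewrite lexx.
exists (`|F 0| + K * W) => [|t /andP[t0 tT]].
  by rewrite addr_ge0// mulr_ge0.
rewrite -[F t](subrK (F 0)) (le_trans (ler_normD _ _))// addrC lerD2l.
rewrite (le_trans (HF _ _ _ _ _))// ler_wpM2l// HW//.
by rewrite t0.
Qed.

Lemma wlip_cst (c : R) : wlip (fun=> c).
Proof. by exists 0 => // s t *; rewrite subrr normr0 mul0r. Qed.

Lemma wlipD F G : wlip F -> wlip G -> wlip (fun t => F t + G t).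
Proof.
move=> [K K0 HF] [K' K'0 HG]; exists (K + K'); first exact: addr_ge0.
move=> s t s0 st tT; rewrite opprD addrACA mulrDl.
by rewrite (le_trans (ler_normD _ _))// lerD ?HF ?HG.
Qed.

Lemma wlipN F : wlip F -> wlip (fun t => - F t).
Proof.
by move=> [K K0 HF]; exists K => // s t s0 st tT; rewrite -opprD normrN HF.
Qed.

(** Boundedness on [[0, T]] turns the product rule for increments into a gauge bound. *)
Lemma wlipM F G : wlip F -> wlip G -> wlip (fun t => F t * G t).
Proof.
move=> wF wG; have [M M0 HM] := wlip_bounded _ wF.
have [N N0 HN] := wlip_bounded _ wG.
case: wF wG => [K K0 HF] [K' K'0 HG]; exists (M * K' + N * K).
  by rewrite addr_ge0// mulr_ge0.
move=> s t s0 st tT.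
have -> : F t * G t - F s * G s = F t * (G t - G s) + G s * (F t - F s) by ring.
rewrite (le_trans (ler_normD _ _))// !normrM mulrDl -!mulrA lerD// ler_pM//.
- by apply: HM; rewrite tT (le_trans s0).
- exact: HG.
- by apply: HN; rewrite s0 (le_trans st).
- exact: HF.
Qed.

Lemma wlip_sum (I : Type) (r : seq I) (F : I -> R -> R) :
  (forall i, wlip (F i)) -> wlip (fun t => \sum_(i <- r) F i t).
Proof.
move=> wF; elim: r => [|i r IH].
  by under eq_fun do rewrite big_nil; exact: wlip_cst.
by under eq_fun do rewrite big_cons; exact: wlipD.
Qed.

Lemma wlip_norm F : wlip F -> wlip (fun t => `|F t|).
Proof.
move=> [K K0 HF]; exists K => // s t s0 st tT.
exact: le_trans (ler_dist_dist _ _) (HF _ _ _ _ _).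
Qed.

Lemma wlip_min F G : wlip F -> wlip G -> wlip (fun t => Num.min (F t) (G t)).
Proof.
move=> wF wG; under eq_fun do rewrite minr_absE.
apply: wlipM; last exact: wlip_cst.
apply: wlipD; first exact: wlipD.
by apply: wlipN; apply: wlip_norm; apply: wlipD => //; exact: wlipN.
Qed.

Lemma wlip_bigmin (I : Type) (r : seq I) F0 (F : I -> R -> R) :
  wlip F0 -> (forall i, wlip (F i)) ->
  wlip (fun t => \big[Num.min/F0 t]_(i <- r) F i t).
Proof.
move=> wF0 wF; elim: r => [|i r IH].
  by under eq_fun do rewrite big_nil.
by under eq_fun do rewrite big_cons; exact: wlip_min.
Qed.

Lemma wlip_abs_cont F :
  (forall e : R, 0 < e -> exists2 d : R, 0 < d &
    forall (k : nat) (a b : nat -> R),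
      (forall i, (i < k)%N -> [&& 0 <= a i, a i <= b i & b i <= T]) ->
      (forall i j, (i < j < k)%N -> b i <= a j) ->
      \sum_(i < k) (b i - a i) < d -> \sum_(i < k) w (a i) (b i) < e) ->
  wlip F -> real_abs_cont_on T F.
Proof.
move=> acw [K K0 HF] e e0.
(* [K] may be 0, so the tolerance is divided by [K + 1]. *)
have K1 : 0 < K + 1 by rewrite ltr_wpDl.
have [d d0 Hd] := acw _ (divr_gt0 e0 K1); exists d => // k a b Hab Hdis Hlen.
have {Hlen} := Hd k a b Hab Hdis Hlen.
rewrite ltr_pdivlMr// mulrC; apply: le_lt_trans.
rewrite mulr_sumr; apply: ler_sum => i _.
have /and3P[a0 ab bT] := Hab i (ltn_ord i).
rewrite (le_trans (HF _ _ _ _ _))// ler_wpM2r ?w_ge0//.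
by rewrite lerDl.
Qed.

End gauge_lipschitz.

(** * Gauge bounds for the energy along absolutely continuous curves *)

Section increments_along_curves.
Context {R : realType} {n : nat}.
Implicit Types (x y : 'rV[R]_n) (X Z : R -> 'rV[R]_n).

(** The tangent inequalities at the two end points bound the increment from both sides, without a
    mean value theorem. *)
Lemma strongly_convex_increment (f : 'rV[R]_n -> R) g (mu : R) x y :
  0 <= mu -> strongly_convex f g mu ->
  `|f y - f x| <= (enorm (g x) + enorm (g y)) * enorm (y - x).
Proof.
move=> mu0 sc.
have tangent a b : f a - f b <= enorm (g a) * enorm (a - b).
  have := sc a b; have := dotv_le_enorm (g a) (a - b).
  have : 0 <= mu / 2 * enorm (b - a) ^+ 2.
    by rewrite mulr_ge0 ?sqr_ge0// divr_ge0.
  by rewrite -(opprB a b) dotvNr enormN; lra.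
have := tangent x y; have := tangent y x; rewrite (enormB x y) => H1 H2.
have p0 a : 0 <= enorm (g a) * enorm (y - x) by rewrite mulr_ge0 ?enorm_ge0.
have := p0 x; have := p0 y; rewrite ler_norml mulrDl; lra.
Qed.

(** The three terms dominate respectively the increments of the objectives along [X], of the
    coordinates of [Z], and of the exponentials of time. *)
Definition gauge X Z (s t : R) : R :=
  enorm (X t - X s) + enorm (Z t - Z s) + (t - s).

Lemma gauge_ge0 X Z (T s t : R) : 0 <= s -> s <= t -> t <= T -> 0 <= gauge X Z s t.
Proof. by move=> _ st _; rewrite addr_ge0 ?subr_ge0// addr_ge0 ?enorm_ge0. Qed.

Lemma gauge_bounded X Z (T : R) : 0 < T ->
  abs_cont_on 0 T X -> abs_cont_on 0 T Z ->
  exists W, forall t, 0 <= t <= T -> gauge X Z 0 t <= W.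
Proof.
move=> T0 hX hZ.
have [W HW] := abs_cont_bounded _ _ T0 hX.
have [W' HW'] := abs_cont_bounded _ _ T0 hZ.
exists (W + W' + T) => t tT; rewrite !lerD ?HW ?HW'//.
by rewrite subr0; case/andP: tT.
Qed.

Lemma gauge_abs_cont X Z (T : R) :
  abs_cont_on 0 T X -> abs_cont_on 0 T Z ->
  forall e : R, 0 < e -> exists2 d : R, 0 < d &
    forall (k : nat) (a b : nat -> R),
      (forall i, (i < k)%N -> [&& 0 <= a i, a i <= b i & b i <= T]) ->
      (forall i j, (i < j < k)%N -> b i <= a j) ->
      \sum_(i < k) (b i - a i) < d -> \sum_(i < k) gauge X Z (a i) (b i) < e.
Proof.
move=> hX hZ e e0; have e3 : 0 < e / 3 by rewrite divr_gt0.
have [d d0 Hd] := hX _ e3; have [d' d'0 Hd'] := hZ _ e3.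
(* The time part of the gauge sums to the total length itself, so it is kept below [e / 3]
   directly. *)
exists (Num.min (e / 3) (Num.min d d')); first by rewrite !lt_min e3 d0.
move=> k a b Hab Hdis; rewrite !lt_min => /and3P[l1 l2 l3].
have Hdis' (i j : 'I_k) : i != j -> b i <= a j \/ b j <= a i.
  rewrite -val_eqE neq_ltn => /orP[ij|ji]; [left|right]; apply: Hdis.
    by rewrite ij /=.
  by rewrite ji /=.
have H1 := Hd k a b (fun i => Hab i (ltn_ord i)) Hdis' l2.
have H2 := Hd' k a b (fun i => Hab i (ltn_ord i)) Hdis' l3.
rewrite big_split/= big_split/=; move: l1 H1 H2; lra.
Qed.

Section gauge.
Variables (X Z : R -> 'rV[R]_n) (T : R).
Hypothesis T_gt0 : 0 < T.
Hypotheses (hX : abs_cont_on 0 T X) (hZ : abs_cont_on 0 T Z).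
Local Notation W := (gauge X Z).
Local Notation lip := (wlip T W).

(** From [1 + (s - t) <= expR (s - t)], the increment is at most [expR t * (t - s)]. *)
Lemma wlip_expR : lip expR.
Proof.
exists (expR T); first exact: expR_ge0.
move=> s t s0 st tT; rewrite ger0_norm ?subr_ge0 ?ler_expR//.
apply: (@le_trans _ _ (expR T * (t - s))); last first.
  by rewrite ler_wpM2l ?expR_ge0// lerDr addr_ge0 ?enorm_ge0.
apply: (@le_trans _ _ (expR t * (t - s))); last first.
  by rewrite ler_wpM2r ?subr_ge0// ler_expR.
have := expR_ge1Dx (s - t) => H.
have -> : expR s = expR t * expR (s - t) by rewrite -expRD addrC subrK.
have := ler_wpM2l (expR_ge0 t) H; lra.
Qed.

Lemma wlip_expRN : lip (fun t => expR (- t)).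
Proof.
exists 1 => // s t s0 st tT; rewrite distrC ger0_norm ?subr_ge0 ?ler_expR ?lerN2//.
apply: (@le_trans _ _ (t - s)); last first.
  by rewrite mul1r lerDr addr_ge0 ?enorm_ge0.
have := expR_ge1Dx (s - t) => H.
have -> : expR (- t) = expR (- s) * expR (s - t) by rewrite -expRD addrA addNr add0r.
have := ler_wpM2l (expR_ge0 (- s)) H.
have : expR (- s) * (t - s) <= 1 * (t - s).
  rewrite ler_wpM2r ?subr_ge0//.
  by rewrite -[leRHS]expR0 ler_expR oppr_le0.
lra.
Qed.

Lemma wlip_coord (i : 'I_n) : lip (fun t => Z t 0 i).
Proof.
exists 1 => // s t s0 st tT; rewrite mul1r.
have := coord_le_enorm (Z t - Z s) i; rewrite !mxE => /le_trans; apply.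
by rewrite /gauge -addrA addrCA lerDl addr_ge0 ?enorm_ge0 ?subr_ge0.
Qed.

(** [X] stays bounded on [[0, T]], so its gradients have norm at most [G]; the two end points give
    the constant [G + G]. *)
Lemma wlip_comp (f : 'rV[R]_n -> R) g (mu L : R) : 0 <= mu ->
  strongly_convex f g mu -> lipschitz_grad g L -> lip (f \o X).
Proof.
move=> mu0 sc lg; have [M HM] := abs_cont_bounded _ _ T_gt0 hX.
pose G := enorm (g (X 0)) + `|L| * M.
have M0 : 0 <= M by apply: (le_trans (enorm_ge0 (X 0 - X 0))); apply: HM; rewrite lexx ltW.
have HG t : 0 <= t -> t <= T -> enorm (g (X t)) <= G.
  move=> t0 tT; rewrite -[g (X t)](subrK (g (X 0))) (le_trans (ler_enormD _ _))//.
  rewrite addrC lerD2l (le_trans (lg _ _))//.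
  apply: (@le_trans _ _ (`|L| * enorm (X t - X 0))).
    by rewrite ler_wpM2r ?enorm_ge0// ler_norm.
  by rewrite ler_wpM2l// HM// t0.
exists (G + G).
  by rewrite !addr_ge0 ?enorm_ge0// mulr_ge0.
move=> s t s0 st tT /=.
rewrite (le_trans (strongly_convex_increment _ _ _ _ _ mu0 sc))// ler_pM//.
- by rewrite addr_ge0 ?enorm_ge0.
- exact: enorm_ge0.
- by rewrite lerD// HG// ?(le_trans st)// (le_trans s0).
- by rewrite /gauge -addrA lerDl addr_ge0 ?enorm_ge0 ?subr_ge0.
Qed.

(** The scaled energy is built by sums, products and minima from functions already bounded by the
    gauge; the squared norm is expanded into coordinates for this. *)
Lemma abs_cont_scaled_energy (m : nat) (f : 'I_m.+1 -> 'rV[R]_n -> R)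
    (g : 'I_m.+1 -> 'rV[R]_n -> 'rV[R]_n) (L mu : 'I_m.+1 -> R) (mu0 gamma0 : R) z :
  (forall j, lipschitz_grad (g j) (L j)) ->
  (forall j, strongly_convex (f j) (g j) (mu j)) -> (forall j, 0 <= mu j) ->
  real_abs_cont_on T (fun t => expR t * energy f (gammaf mu0 gamma0) X Z z t).
Proof.
move=> hlip hsc hmu.
have w0 := @gauge_ge0 X Z T.
have wb := gauge_bounded _ _ _ T_gt0 hX hZ.
have T0 := ltW T_gt0.
have wM := wlipM _ _ T0 w0 wb.
apply: (wlip_abs_cont _ _ w0) (gauge_abs_cont _ _ _ hX hZ) _.
apply: (wM); first exact: wlip_expR.
apply: wlipD.
  apply: (wlip_bigmin _ _ T0 w0 wb) => [|j]; apply: wlipD; try exact: wlip_cst.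
    exact: wlip_comp (hsc ord0) (hlip ord0).
  exact: wlip_comp (hsc j) (hlip j).
apply: (wM).
  apply: (wM); last exact: wlip_cst.
  apply: wlipD; first exact: wlip_cst.
  by apply: (wM); [exact: wlip_cst | exact: wlip_expRN].
under eq_fun do rewrite enorm_sqr.
apply: wlip_sum => i; apply: (wM); under eq_fun do rewrite !mxE; apply: wlipD;
  by [exact: wlip_coord | exact: wlip_cst].
Qed.

End gauge.
End increments_along_curves.

(** * Dissipation of the energy *)

Section energy_dissipation.
Context {R : realType} {n m : nat}.
Variables (f : 'I_m.+1 -> 'rV[R]_n -> R) (g : 'I_m.+1 -> 'rV[R]_n -> 'rV[R]_n).
Variable mu : 'I_m.+1 -> R.
Implicit Types (x y z v : 'rV[R]_n).

Lemma fgap_le x z j : fgap f x z <= f j x - f j z.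
Proof. exact: bigmin_le. Qed.

Lemma fgap_attained x z : exists j, fgap f x z = f j x - f j z.
Proof.
rewrite /fgap; elim/big_ind : _ => [|a b [i ->] [j ->]|j _]; last by exists j.
  by exists ord0.
by case: leP => _; [exists i | exists j].
Qed.

Lemma minmu_le j : minmu mu <= mu j.
Proof. exact: bigmin_le. Qed.

Lemma minmu_ge0 : (forall j, 0 <= mu j) -> 0 <= minmu mu.
Proof. by move=> mu0; apply/bigmin_geP. Qed.

Lemma convC_gradient x j : Defs.convC g x (g j x).
Proof.
exists (fun i => (i == j)%:R); split=> [i|]; first by rewrite ler0n.
split; first by rewrite (bigD1 j)//= eqxx big1 ?addr0// => i /negbTE ->.
rewrite (bigD1 j)//= eqxx scale1r big1 ?addr0// => i /negbTE ->.
by rewrite scale0r.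
Qed.

(** Average over [j], with the weights of [v], the strong convexity inequalities from [x] to [z];
    each gap [f j x - f j z] is at least [fgap f x z]. *)
Lemma convC_gap x z v : (forall j, strongly_convex (f j) (g j) (mu j)) ->
  Defs.convC g x v ->
  dotv v (z - x) <= - fgap f x z - minmu mu / 2 * enorm (z - x) ^+ 2.
Proof.
move=> sc [lam [lam0 [lam1 ->]]]; rewrite dotv_suml -[leRHS]mul1r -{1}lam1 mulr_suml.
apply: ler_sum => j _; rewrite ler_wpM2l//.
have := sc j x z; have := fgap_le x z j.
have := ler_wpM2r (sqr_ge0 (enorm (z - x))) (minmu_le j) => /=.
lra.
Qed.

(** With [x], [y], [p] standing for [X], [Z], [Z'] and [j] active, the left side is the derivative
    of the energy. Minimality of [v] against [g j x] replaces the gradient by [v]; the terms in [v]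
    then combine into [dotv v (z - x)], bounded by [convC_gap]. *)
Lemma dissipation x y z p v (gam : R) j :
  (forall j, strongly_convex (f j) (g j) (mu j)) ->
  argminC g x (x - y) v -> gam *: p = minmu mu *: (x - y) - v ->
  dotv (g j x) (y - x) + (minmu mu - gam) / 2 * enorm (y - z) ^+ 2
    + gam * dotv (y - z) p
  <= - (fgap f x z + gam / 2 * enorm (y - z) ^+ 2)
     - minmu mu / 2 * enorm (y - x) ^+ 2.
Proof.
move=> sc [cv vmin] ode; rewrite -dotvZr ode.
have := vmin _ (convC_gradient x j); have := convC_gap x z v sc cv.
have -> : y - z = (y - x) + (x - z) by rewrite addrA subrK.
rewrite -(opprB y x) -(opprB x z) enormN.
(* In terms of [a] and [b] the remaining quadratic terms cancel, except for minus half of [minmu mu]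
   times the square of [a]. *)
move: (y - x) (x - z) => a b; rewrite !enorm_sqr.
rewrite !(dotvDl, dotvDr, dotvNl, dotvNr, dotvZr).
rewrite (dotvC b a) (dotvC a v) (dotvC b v) (dotvC a (g j x)).
lra.
Qed.

Lemma is_derive_comp_gradient (h : 'rV[R]_n -> R) dh (X : R -> 'rV[R]_n) (t : R) :
  is_gradient h dh -> derivable X t 1 ->
  is_derive t 1 (h \o X) (dotv (dh (X t)) ('D_1 X t)).
Proof.
move=> gh /derivable1_diffP dX; have [dhX dhE] := gh (X t).
have dcomp : differentiable (h \o X) t by exact: differentiable_comp.
apply: DeriveDef; first exact/derivable1_diffP.
by rewrite deriveE// diff_comp//= dhE deriveE.
Qed.

Lemma is_derive_enorm_sqr (Z : R -> 'rV[R]_n) z (t : R) : derivable Z t 1 ->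
  is_derive t 1 (fun s => enorm (Z s - z) ^+ 2) (2 * dotv (Z t - z) ('D_1 Z t)).
Proof.
move=> dZ.
(* As a sum of coordinate squares, the function can be differentiated by the scalar rules. *)
have -> : (fun s => enorm (Z s - z) ^+ 2) =
    \sum_(i < n) ((fun s => Z s 0 i) - cst (z 0 i)) ^+ 2.
  apply/funext => s; rewrite enorm_sqr fct_sumE.
  by apply: eq_bigr => i _; rewrite !mxE.
have dZi i : is_derive t 1 (fun s => Z s 0 i) ('D_1 Z t 0 i).
  apply: DeriveDef; first by have /derivable_mxP := dZ; apply.
  by rewrite derive_mx// mxE.
apply: is_derive_eq.
rewrite /dotv mulr_sumr; apply: eq_bigr => i _.
rewrite subr0 !mxE /= expr1 -[LHS]/(2 * (Z t 0 i - z 0 i) * _).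
by rewrite mulrA.
Qed.

Lemma is_derive_gammaf (mu0 gamma0 t : R) :
  is_derive t 1 (gammaf mu0 gamma0) (mu0 - gammaf mu0 gamma0 t).
Proof.
have -> : gammaf mu0 gamma0 = cst mu0 + (gamma0 - mu0) \*: (expR \o -%R).
  by apply/funext.
have H : is_derive t 1 (expR \o -%R) (- expR (- t) : R).
  rewrite -mulrN1.
  exact: (is_derive1_comp (is_derive_expR (- t)) (is_deriveNid t 1)).
apply: is_derive_eq.
rewrite /gammaf -[LHS]/(0 + (gamma0 - mu0) * (- expR (- t))).
by rewrite opprD addrA subrr mulrN.
Qed.

(** For [j] active at [t], the [j]-th gap minus the minimum is nonnegative and vanishes at [t], so
    its derivative there is 0. *)
Lemma derive_fgap (X : R -> 'rV[R]_n) z (t : R) :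
  (forall j, is_gradient (f j) (g j)) -> derivable X t 1 ->
  derivable (fun s => fgap f (X s) z) t 1 ->
  exists j, 'D_1 (fun s => fgap f (X s) z) t = dotv (g j (X t)) ('D_1 X t).
Proof.
move=> gf dX dF; have [j Hj] := fgap_attained (X t) z; exists j.
have dj := is_derive_comp_gradient _ _ _ _ (gf j) dX.
have dj' : is_derive t 1 ((f j \o X) - cst (f j z)) (dotv (g j (X t)) ('D_1 X t)).
  by apply: is_derive_eq; rewrite subr0.
have [dj1 dj2] := dj'.
have := derive_at_global_min ((f j \o X) - cst (f j z) - (fun s => fgap f (X s) z)) t.
rewrite deriveB// dj2 => H; apply/esym/eqP; rewrite -subr_eq0; apply/eqP/H.
  exact: derivableB.
move=> s; rewrite -[leLHS]/(f j (X t) - f j z - fgap f (X t) z).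
rewrite -[leRHS]/(f j (X s) - f j z - fgap f (X s) z) Hj subrr subr_ge0.
exact: fgap_le.
Qed.

Lemma energy_dissipation (X Z : R -> 'rV[R]_n) (gamma0 : R) z (t : R) v :
  (forall j, is_gradient (f j) (g j)) ->
  (forall j, strongly_convex (f j) (g j) (mu j)) ->
  derivable X t 1 -> derivable Z t 1 -> 'D_1 X t = Z t - X t ->
  argminC g (X t) (X t - Z t) v ->
  gammaf (minmu mu) gamma0 t *: 'D_1 Z t = minmu mu *: (X t - Z t) - v ->
  derivable (fun s => fgap f (X s) z) t 1 ->
  let E := energy f (gammaf (minmu mu) gamma0) X Z z in
  derivable E t 1 /\
  'D_1 E t <= - E t - minmu mu / 2 * enorm (Z t - X t) ^+ 2.
Proof.
move=> gf sc dX dZ dXE vmin ode dF E.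
have [j Dj] := derive_fgap X z t gf dX dF.
pose gam := gammaf (minmu mu) gamma0.
pose Q s := enorm (Z s - z) ^+ 2.
have dQ := is_derive_enorm_sqr Z z t dZ.
have dg := is_derive_gammaf (minmu mu) gamma0 t.
have dF' := derivableP dF.
have dE : is_derive t 1 E (dotv (g j (X t)) (Z t - X t)
    + (minmu mu - gam t) / 2 * Q t + gam t * dotv (Z t - z) ('D_1 Z t)).
  have -> : E = (fun s => fgap f (X s) z) + 2^-1 \*: (gam * Q).
    apply/funext => s.
    by rewrite -[RHS]/(fgap f (X s) z + 2^-1 * (gam s * Q s)) mulrCA mulrA.
  apply: is_derive_eq; rewrite Dj dXE.
  rewrite -[LHS]/(_ + 2^-1 * (gam t * (2 * dotv (Z t - z) ('D_1 Z t)) +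
    Q t * (minmu mu - gam t))).
  by field.
case: dE => dE1 dE2; split; first exact: dE1.
by rewrite dE2; exact: (dissipation _ _ _ _ v).
Qed.

End energy_dissipation.

(** * From pointwise dissipation to exponential decay *)

Theorem mainTheorem6 (R : realType) (n m : nat)
  (f : 'I_m.+1 -> 'rV[R]_n -> R) (g : 'I_m.+1 -> 'rV[R]_n -> 'rV[R]_n)
  (L mu : 'I_m.+1 -> R)
  (hgrad : forall j, is_gradient (f j) (g j))
  (hlip : forall j, lipschitz_grad (g j) (L j))
  (hsc : forall j, strongly_convex (f j) (g j) (mu j))
  (hmu : forall j, 0 <= mu j /\ mu j <= L j)
  (gamma0 : R) (hg0 : 0 < gamma0) (x0 x1 : 'rV[R]_n)
  (X Z : R -> 'rV[R]_n)
  (hX : loc_abs_cont X) (hZ : loc_abs_cont Z)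
  (hX0 : X 0 = x0) (hZ0 : Z 0 = x0 + x1)
  (hode : {ae (@lebesgue_measure R), forall t : R, 0 < t ->
     [/\ derivable X t 1, derivable Z t 1,
         derive1 X t = Z t - X t &
         exists2 v, argminC g (X t) (X t - Z t) v &
           gammaf (minmu mu) gamma0 t *: derive1 Z t
             = minmu mu *: (X t - Z t) - v]}) :
  forall z : 'rV[R]_n,
    {ae (@lebesgue_measure R), forall t : R, 0 < t ->
       derivable (energy f (gammaf (minmu mu) gamma0) X Z z) t 1 /\
       derive1 (energy f (gammaf (minmu mu) gamma0) X Z z) t
         <= - energy f (gammaf (minmu mu) gamma0) X Z z t
            - minmu mu / 2 * enorm (Z t - X t) ^+ 2}
    /\
    (forall t : R, 0 < t ->
       fgap f (X t) z + gammaf (minmu mu) gamma0 t / 2 * enorm (Z t - z) ^+ 2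
         <= expR (- t) * (fgap f x0 z + gamma0 / 2 * enorm (x0 + x1 - z) ^+ 2)).
Proof.
move=> z.
have mu0 j : 0 <= mu j by case: (hmu j).
pose E := energy f (gammaf (minmu mu) gamma0) X Z z.
pose P t := derivable E t 1 /\
  derive1 E t <= - E t - minmu mu / 2 * enorm (Z t - X t) ^+ 2.
have dissip : {ae (@lebesgue_measure R), forall t, 0 < t -> P t}.
  (* Each gap is differentiable wherever [X] is; their minimum then is so almost everywhere. *)
  have gap j : {ae (@lebesgue_measure R), forall t,
      [set s | 0 < s] t -> derivable (fun s => f j (X s) - f j z) t 1}.
    move: hode; apply: (@filterS _ _ ae_lebesgue_filter) => t + t0.
    move=> /(_ t0) [dX _ _ _]; apply: derivableB => //.
    by have [] := is_derive_comp_gradient _ _ _ _ (hgrad j) dX.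
  have := ae_derivable_bigmin _ (index_enum 'I_m.+1) _ _ _ (gap ord0) gap.
  move: hode; apply: (@filterS2 _ _ ae_lebesgue_filter) => t + + t0.
  move=> /(_ t0) [dX dZ dXE [v vmin ode]] /(_ t0) dF.
  rewrite /P derive1E; rewrite !derive1E in dXE ode.
  exact: (energy_dissipation f g mu X Z gamma0 z t v).
split; first exact: dissip.
move=> t t0.
have acE := abs_cont_scaled_energy X Z t t0 (hX t t0) (hZ t t0)
  m f g L mu (minmu mu) gamma0 z hlip hsc mu0.
(* [expR] is the integrating factor: the derivative of the product is [expR s] times
   ['D_1 E s + E s], which dissipation makes nonpositive. *)
have decr : expR t * E t <= expR 0 * E 0.
  apply: (abs_cont_nonincreasing _ _ t0 acE).
  move: dissip; apply: (@filterS _ _ ae_lebesgue_filter) => s + s0.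
  move=> /(_ s0) [dE]; rewrite derive1E => dEle.
  have dEE : is_derive s 1 (expR * E) (expR s * 'D_1 E s + E s * expR s).
    exact: (is_deriveM (is_derive_expR s) (derivableP dE)).
  have [d1 d2] := dEE; split; first exact: d1.
  rewrite [leLHS]d2 mulrC -mulrDl.
  have : 0 <= minmu mu / 2 * enorm (Z s - X s) ^+ 2.
    by rewrite mulr_ge0 ?sqr_ge0// divr_ge0// minmu_ge0.
  by move=> q; rewrite pmulr_lle0 ?expR_gt0//; lra.
rewrite -[leLHS]/(E t) -hZ0 -hX0.
have -> : fgap f (X 0) z + gamma0 / 2 * enorm (Z 0 - z) ^+ 2 = E 0.
  by rewrite /E /energy /gammaf oppr0 expR0 mulr1 [minmu mu + _]addrC subrK.
rewrite expR0 mul1r in decr.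
by rewrite expRN mulrC ler_pdivlMr ?expR_gt0// mulrC.
Qed.
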